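(* Let $t$ and $k\ge 2$ be positive integers. If $H$ is a finite set of $k$-wise intersecting $t$-intervals, then there is a subset $F\subseteq H$ with $|F|\ge \frac{(k-1)|H|}{k+1}$ that is weakly intersecting.
   Context: Let $R_1,\dots,R_t$ be disjoint parallel lines in the plane. A $t$-interval is a set of the form $I_1\cup\dots\cup I_t$ where each $I_j$ is a closed interval contained in $R_j$. A family of $t$-intervals is $k$-wise intersecting if any $k$ members of it (not necessarily distinct) have a common point. A family of $t$-intervals is weakly intersecting if there is a set $P$ of points containing at most one point from each line $R_i$ such that every member of the family contains a point of $P$. *)

(* Defs.v *)
From mathcomp Require Import all_boot all_order all_algebra finmap.
From mathcomp Require Import all_classical reals.

Set Implicit Arguments.
Unset Strict Implicit.
Unset Printing Implicit Defensive.

Import Order.TTheory GRing.Theory Num.Theory.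

Local Open Scope classical_set_scope.
Local Open Scope ring_scope.

Notation plane R := ('rV[R]_2).

Section TIntervals.
Context {R : realType}.

Definition line_through (a v : plane R) : set (plane R) :=
  [set x | exists s : R, x = a + s *: v].

Definition disjoint_parallel_lines (t : nat) (L : 'I_t -> set (plane R)) :
    Prop :=
  (exists2 v : plane R, v != 0 &
     forall j, exists a : plane R, L j = line_through a v)
  /\ (forall i j, i != j -> L i `&` L j = set0).

(* The endpoints may coincide, so single points are allowed; closed intervals
   are never empty. *)
Definition closed_interval (I : set (plane R)) : Prop :=
  exists p q : plane R,
    I = [set x | exists2 s : R, 0 <= s <= 1 & x = (1 - s) *: p + s *: q].

Definition is_tinterval (t : nat) (L : 'I_t -> set (plane R))
    (A : set (plane R)) : Prop :=
  exists2 I : 'I_t -> set (plane R),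
    forall j, closed_interval (I j) /\ I j `<=` L j &
    A = \bigcup_j I j.

Definition kwise_intersecting (k : nat) (H : {fset set (plane R)}) : Prop :=
  forall A : 'I_k -> set (plane R),
    (forall i, A i \in H) -> \bigcap_i A i !=set0.

Definition weakly_intersecting (t : nat) (L : 'I_t -> set (plane R))
    (F : {fset set (plane R)}) : Prop :=
  exists2 P : set (plane R),
    forall j, is_subset1 (P `&` L j) &
    forall A, A \in F -> A `&` P !=set0.

End TIntervals.

(* Main.v *)
(** Given a [(k-1)]-tuple [f] of members of [H], choose on every line the
    smallest right endpoint among the members of [f].  If [k] members [g] meet
    at a point of line [j], let [g i0] have the smallest right endpoint there.
    For every [i <> i0] the point chosen on line [j] for [g] without [g i] is
    the right endpoint of [g i0], which lies in [g i].  So among the pairs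
    (tuple, member) a proportion of at least [(k-1)/k] are hit, and some tuple
    [f] attains this proportion, which is even better than [(k-1)/(k+1)]. *)
Require Import Defs.
From mathcomp Require Import all_boot all_order all_algebra finmap.
From mathcomp Require Import all_classical reals.
From mathcomp Require Import lra.

Set Implicit Arguments.
Unset Strict Implicit.
Unset Printing Implicit Defensive.

Import Order.TTheory GRing.Theory Num.Theory.

Local Open Scope classical_set_scope.
Local Open Scope ring_scope.

Definition ffun_drop (T : Type) (m : nat) (i : 'I_m.+1)
    (g : {ffun 'I_m.+1 -> T}) : {ffun 'I_m -> T} :=
  [ffun j => g (lift i j)].

Definition ffun_insert (T : Type) (m : nat) (i : 'I_m.+1)
    (p : {ffun 'I_m -> T} * T) : {ffun 'I_m.+1 -> T} :=
  [ffun j => if unlift i j is Some j' then p.1 j' else p.2].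

Lemma ffun_insertK (T : Type) (m : nat) (i : 'I_m.+1) :
  cancel (@ffun_insert T m i) (fun g => (ffun_drop i g, g i)).
Proof.
move=> [f B]; congr pair; last by rewrite ffunE unlift_none.
by apply/ffunP => j; rewrite !ffunE liftK.
Qed.

Lemma ffun_dropK (T : Type) (m : nat) (i : 'I_m.+1) :
  cancel (fun g => (ffun_drop i g, g i)) (@ffun_insert T m i).
Proof.
move=> g; apply/ffunP => j; rewrite ffunE.
by case: unliftP => [j'|] -> //=; rewrite ffunE.
Qed.

(** Splitting off the entry at [i] is a bijection from (m+1)-tuples to pairs of an m-tuple and an
    element. *)
Lemma sum_ffun_drop (T : finType) (m : nat) (i : 'I_m.+1)
    (hit : {ffun 'I_m -> T} -> pred T) :
  (\sum_g (hit (ffun_drop i g) (g i) : nat) = \sum_f #|hit f|)%N.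
Proof.
rewrite (reindex (@ffun_insert T m i)) /=; last first.
  exists (fun g => (ffun_drop i g, g i)) => ? _.
    exact: ffun_insertK.
  exact: ffun_dropK.
rewrite (eq_bigr (fun p : {ffun 'I_m -> T} * T => (hit p.1 p.2 : nat))) =>
  [|p _]; last first.
  by have [-> ->] : (ffun_drop i (ffun_insert i p), ffun_insert i p i) =
    (p.1, p.2) by rewrite (ffun_insertK i p); case: p.
rewrite -(pair_bigA _ (fun f B => (hit f B : nat))) /=.
apply: eq_bigr => f _; rewrite -sum1_card [RHS]big_mkcond /=.
by apply: eq_bigr => B _; rewrite unfold_in; case: (hit f B).
Qed.

(** Double counting of the pairs [(g, i)] that are hits: each [g] gives at least [m] of them, and
    each [i] gives the sum of [#|hit f|] over all [f]. *)
Lemma exists_hit_many (T : finType) (m : nat)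
    (hit : {ffun 'I_m -> T} -> pred T) :
  (0 < #|T|)%N ->
  (forall g : {ffun 'I_m.+1 -> T}, exists i0, forall i, i != i0 ->
     hit (ffun_drop i g) (g i)) ->
  exists f, (m * #|T| <= m.+1 * #|hit f|)%N.
Proof.
move=> T0 hit_all_but_one; apply: contrapT => /forallNP hit_few.
(* The successor records strictness for each [f]; summed up, it leaves a gap of one per tuple, and
   there is a tuple because [T] is nonempty. *)
have few : (\sum_f (m.+1 * #|hit f|).+1 <= \sum_(f : {ffun 'I_m -> T}) m * #|T|)%N.
  by apply: leq_sum => f _; rewrite ltnNge; apply/negP/hit_few.
have many : (\sum_(f : {ffun 'I_m -> T}) m * #|T| <= \sum_f m.+1 * #|hit f|)%N.
  have <- : (\sum_(i < m.+1) \sum_g (hit (ffun_drop i g) (g i) : nat) =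
             \sum_f m.+1 * #|hit f|)%N.
    rewrite [LHS](eq_bigr (fun=> \sum_f #|hit f|)%N) => [|i _]; last first.
      exact: sum_ffun_drop.
    by rewrite sum_nat_const card_ord big_distrr.
  rewrite exchange_big /=.
  have -> : (\sum_(f : {ffun 'I_m -> T}) m * #|T| =
             \sum_(g : {ffun 'I_m.+1 -> T}) m)%N.
    by rewrite !sum_nat_const !card_ffun !card_ord expnSr -mulnA (mulnC m #|T|).
  apply: leq_sum => g _; have [i0 hit_i0] := hit_all_but_one g.
  rewrite (bigD1 i0) //= (eq_bigr (fun=> 1%N)) => [|i /hit_i0 -> //].
  by rewrite sum1_card cardC1 card_ord leq_addl.
have := leq_trans few many.
rewrite (eq_bigr (fun f => (m.+1 * #|hit f|) + 1)%N) => [|f _]; last first.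
  by rewrite addn1.
rewrite big_split /= -[leqRHS]addn0 leq_add2l sum1_card leqNgt.
by rewrite card_ffun expn_gt0 T0.
Qed.

(** The combinatorial core in coordinates: [lo A j] and [hi A j] stand for the endpoints of [A] on
    line [j], and [x j] for the point chosen there. *)
Lemma exists_transversal_many (R : realDomainType) (T J : finType) (m : nat)
    (lo hi : T -> J -> R) :
  (0 < m)%N ->
  (forall g : 'I_m.+1 -> T, exists j s, forall i, lo (g i) j <= s <= hi (g i) j) ->
  exists x : J -> R,
    (m * #|T| <= m.+1 * #|[pred A | [exists j, (lo A j <= x j <= hi A j)%R]]|)%N.
Proof.
(* With [m] positive, [ord0] is available as the default index of the minimum. *)
case: m => [//|m] _ meet.
have [T0|T0] := posnP #|T|; first by exists (fun=> 0); rewrite T0 muln0.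
pose x (f : {ffun 'I_m.+1 -> T}) j := hi (f [arg min_(i < ord0) hi (f i) j]%O) j.
pose hit f := [pred A | [exists j, lo A j <= x f j <= hi A j]].
suff [f ?] : exists f, (m.+1 * #|T| <= m.+2 * #|hit f|)%N by exists (x f).
apply: exists_hit_many => // g.
have [j [s sP]] := meet g.
have [i0 _ i0_min] := arg_minP (fun i => hi (g i) j) (erefl : xpredT (@ord0 m.+1)).
(* Since [i] differs from [i0], the index [i0] survives the removal of [i], at position [i']. *)
exists i0 => i /unlift_some[i' i0E _].
apply/existsP; exists j; rewrite /x.
case: arg_minP => // i1 _ i1_min; apply/andP; split.
  (* The common coordinate [s] separates all left endpoints on line [j] from all right endpoints. *)
  rewrite ffunE; have /andP[/le_trans + _] := sP i; apply.
  by have /andP[] := sP (lift i i1).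
apply: le_trans (i1_min i' isT) _.
by rewrite ffunE -i0E; apply: i0_min.
Qed.

Section ParallelLines.
Context {R : realType}.
Implicit Types (a v : plane R) (I A : set (plane R)).

Lemma closed_interval_on_line a v I :
  closed_interval I -> I `<=` line_through a v ->
  exists lohi : R * R,
    I = [set x | exists2 s, lohi.1 <= s <= lohi.2 & x = a + s *: v].
Proof.
move=> [p [q ->]] sub.
have [|s ps] := sub p.
  by exists 0; rewrite ?lexx ?ler01 // subr0 scale1r scale0r addr0.
have [|r qr] := sub q.
  by exists 1; rewrite ?lexx ?ler01 // subrr scale0r scale1r add0r.
have comb u : (1 - u) *: p + u *: q = a + (s + u * (r - s)) *: v.
  rewrite ps qr !scalerDr addrACA -scalerDl subrK scale1r !scalerA -scalerDl.
  by congr (_ + _ *: _); lra.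
(* The parameters [s] of [p] and [r] of [q] may come in either order. *)
exists (Num.min s r, Num.max s r); apply/seteqP; split => x /=.
  move=> [u /andP[u0 u1] ->]; rewrite comb; exists (s + u * (r - s)) => //.
  by rewrite ge_min le_max; case: (leP s r) => ?; apply/andP; split; apply/orP;
    [left|right|right|left]; nra.
move=> [w wP ->].
(* A one-point interval is treated apart, as the general witness divides by [r - s]. *)
have [rs|rs] := eqVneq s r.
  exists 0; rewrite ?lexx ?ler01 // comb mul0r addr0.
  by move: wP; rewrite rs minxx maxxx -eq_le => /eqP ->.
have rs0 : r - s != 0 by rewrite subr_eq0 eq_sym.
exists ((w - s) / (r - s)); last by rewrite comb divfK // (addrC s) subrK.
move: wP; case: (ltgtP s r) rs => // [sr|rs] _ /andP[? ?].
  by rewrite divr_ge0 ?ler_pdivrMr ?mul1r /=; lra.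
by rewrite -mulrNN -invrN divr_ge0 ?ler_pdivrMr ?mul1r /=; lra.
Qed.

Lemma disjoint_lines_inj (t : nat) (L : 'I_t -> set (plane R)) (x : plane R)
    (i j : 'I_t) :
  (forall i j, i != j -> L i `&` L j = set0) -> L i x -> L j x -> i = j.
Proof.
move=> disj Li Lj; apply/eqP; apply: contraT => /disj E.
by have : set0 x by rewrite -E.
Qed.

Lemma line_through_inj a v : v != 0 -> injective (fun s => a + s *: v).
Proof.
move=> v0 s r /addrI /eqP; rewrite -subr_eq0 -scalerBl scaler_eq0 (negbTE v0).
by rewrite orbF subr_eq0 => /eqP.
Qed.

Lemma tinterval_coord (t : nat) (a : 'I_t -> plane R) v A :
  is_tinterval (fun j => line_through (a j) v) A ->
  exists lohi : 'I_t -> R * R, A = [set x | exists j s,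
    (lohi j).1 <= s <= (lohi j).2 /\ x = a j + s *: v].
Proof.
move=> [I IP ->].
have /choice[lohi lohiP] j := closed_interval_on_line (IP j).1 (IP j).2.
exists lohi; apply/seteqP; split => [x [j _]|x [j [s [sP ->]]]].
  by rewrite lohiP => -[s ? ?]; exists j, s.
by exists j => //; rewrite lohiP; exists s.
Qed.

End ParallelLines.

Theorem theorem1p2 (R : realType) (t k : nat) (ht : (0 < t)%N) (hk : (2 <= k)%N)
    (L : 'I_t -> set (plane R)) (hL : disjoint_parallel_lines L)
    (H : {fset set (plane R)})
    (hH : forall A : set (plane R), A \in H -> is_tinterval L A)
    (hk_int : kwise_intersecting k H) :
  exists F : {fset set (plane R)},
    [/\ (F `<=` H)%fset,
        (k%:R - 1) * #|` H|%:R / (k%:R + 1) <= #|` F|%:R :> R &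
        weakly_intersecting L F].
Proof.
case: k hk hk_int => [//|m] m0 hk_int.
have [[v v0 /choice[a aP]] disj] := hL.
have LE : L = fun j => line_through (a j) v by apply/funext.
have /choice[lohi lohiP] (A : H) : exists lohi : 'I_t -> R * R,
    val A = [set x | exists j s,
      (lohi j).1 <= s <= (lohi j).2 /\ x = a j + s *: v].
  by apply: tinterval_coord; rewrite -LE; exact: hH (valP A).
have onL j s : L j (a j + s *: v) by rewrite aP; exists s.
have [||x xP] := @exists_transversal_many R H 'I_t m
  (fun A j => (lohi A j).1) (fun A j => (lohi A j).2) => //.
  move=> g; have [p gp] := hk_int (fun i => val (g i)) (fun i => valP (g i)).
  have := gp ord0 I; rewrite /= lohiP => -[j [s [_ pE]]].
  exists j, s => i; have := gp i I; rewrite /= lohiP => -[j' [s' [s'P pE']]].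
  (* Disjointness fixes the line through [p], and [v != 0] fixes its parameter, so all members share
     the same [j] and [s]. *)
  have jj' : j' = j.
    by apply: (disjoint_lines_inj disj (x := p)); [rewrite pE'|rewrite pE].
  move: s'P pE'; rewrite jj' pE => s'P.
  by move/(line_through_inj v0) ->.
pose hit : pred H := [pred A | [exists j, (lohi A j).1 <= x j <= (lohi A j).2]].
exists [fset val A | A in hit]%fset; split.
- by apply/fsubsetP => _ /imfsetP[A _ ->]; exact: valP.
- have -> : #|` [fset val A | A in hit]%fset| = #|hit|.
    by rewrite card_imfset /= ?cardE //; exact: val_inj.
  have {}xP : m%:R * #|` H|%:R <= m.+1%:R * #|hit|%:R :> R.
    by rewrite -!natrM ler_nat cardfE.
  rewrite ler_pdivrMr ?ltr_wpDl // -natr1 addrK.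
  (* Here k - 1 is [m], and the factor m + 1 is relaxed to k + 1 = m + 2. *)
  apply: le_trans xP _; rewrite mulrC ler_wpM2l // -natr1; lra.
- exists (range (fun j => a j + x j *: v)) => [j p q|A /imfsetP[B + ->]].
    (* The chosen point with index [i] lies on line [i], hence on line [j] only if [i = j]. *)
    move=> [[i _ <-] /(disjoint_lines_inj disj (onL i (x i))) ->].
    by move=> [[i' _ <-] /(disjoint_lines_inj disj (onL i' (x i'))) ->].
  move=> /existsP[j xj]; exists (a j + x j *: v); split; last by exists j.
  by rewrite lohiP; exists j, (x j).
Qed.
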